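(* Let $\mathcal D$ be a dense linear subspace of a complex Hilbert space $\mathcal H$ and let $\mathcal A\subset\mathcal L^+(\mathcal D)$ be a standard operator $*$-algebra on $\mathcal D$. Suppose that $\Phi\colon\mathcal A\to\mathcal A$ is a bijective linear mapping satisfying $$\Phi(AB^+C)=\Phi(A)\Phi(B)^+\Phi(C)\quad\text{for all }A,B,C\in\mathcal A.$$ Then there are unitary operators $U,V\in\mathcal L^+(\mathcal D)$ such that $$\Phi(A)=UAV\quad\text{for all }A\in\mathcal A.$$
   Context: For a dense linear subspace $\mathcal D$ of a complex Hilbert space $\mathcal H$, $\mathcal L^+(\mathcal D)$ denotes the set of all linear operators $A\colon\mathcal D\to\mathcal D$ whose Hilbert space adjoint $A^*$ is defined on $\mathcal D$ and satisfies $A^*\mathcal D\subset\mathcal D$. It is a $*$-algebra with the usual operations and the involution $A\mapsto A^+:=A^*|_{\mathcal D}$. $\mathcal F(\mathcal D)\subset\mathcal L^+(\mathcal D)$ is the ideal of all finite rank operators in $\mathcal L^+(\mathcal D)$. A standard operator $*$-algebra on $\mathcal D$ is a (complex) $*$-subalgebra of $\mathcal L^+(\mathcal D)$ containing $\mathcal F(\mathcal D)$. An operator $U\in\mathcal L^+(\mathcal D)$ is called unitary if its closure is a unitary operator on $\mathcal H$. No further assumption (such as completeness in the graph topology) is made on $\mathcal D$. *)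

(* Defs.v *)
From HB Require Import structures.
From mathcomp Require Import all_boot all_order all_algebra sesquilinear.
From mathcomp Require Import complex.
From mathcomp Require Import boolp classical_sets functions reals topology normedtype.

Set Implicit Arguments.
Unset Strict Implicit.
Unset Printing Implicit Defensive.

Import Order.TTheory GRing.Theory Num.Theory Num.Def.

Local Open Scope classical_set_scope.
Local Open Scope ring_scope.

(* Inner products [{dot H for conjC}] are linear in the first argument and
   conjugate linear in the second. *)

Section DomainType.
Context {R : realType} {H : lmodType R[i]} (D : submodClosed H).

Definition dom : Type := {x : H | x \in D}.

HB.instance Definition _ := SubType.copy dom {x : H | x \in D}.
HB.instance Definition _ := [Choice of dom by <:].
HB.instance Definition _ := [SubChoice_isSubLmodule of dom by <:].

End DomainType.

Section Operators.
Context {R : realType} {H : completeNormedModType R[i]}.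
Variables (ip : {dot H for conjC}) (D : submodClosed H).

Implicit Types (A U : dom D -> dom D) (T : H -> H).

(* [z] is a value of the Hilbert space adjoint of [A] at [y]; it is unique
   when [D] is dense. *)
Definition is_adjoint A (y z : H) :=
  forall x : dom D, ip (val (A x)) y = ip (val x) z.

Definition adjoint_dom A : set H := [set y | exists z, is_adjoint A y z].

(* The value [0] outside [adjoint_dom A] is a dummy. *)
Definition adjoint A (y : H) : H := xget 0 [set z | is_adjoint A y z].

Definition Lplus : set (dom D -> dom D) := [set A |
  linear A /\
  forall y : dom D, adjoint_dom A (val y) /\ adjoint A (val y) \in D].

(* [A^+ := A^*|_D]; [insubd] only acts as a cast when [A] is in [Lplus]. *)
Definition dagger A : dom D -> dom D := fun y => insubd 0 (adjoint A (val y)).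

Definition finite_rank A := exists (n : nat) (e : 'I_n -> dom D),
  forall x, exists c : 'I_n -> R[i], A x = \sum_(i < n) c i *: e i.

Definition Fin : set (dom D -> dom D) := Lplus `&` finite_rank.

(* The [*]-subalgebras are not required to contain the identity. *)
Definition star_subalgebra (AA : set (dom D -> dom D)) : Prop :=
  [/\ AA `<=` Lplus,
      AA 0,
      forall (c : R[i]) A B, AA A -> AA B -> AA (c *: A + B),
      forall A B, AA A -> AA B -> AA (A \o B) &
      forall A, AA A -> AA (dagger A)].

Definition standard_star_algebra (AA : set (dom D -> dom D)) : Prop :=
  star_subalgebra AA /\ Fin `<=` AA.

Definition unitary_on_H T : Prop :=
  [/\ linear T, bijective T & forall x y, ip (T x) (T y) = ip x y].

Definition op_graph A : set (H * H) := [set (val x, val (A x)) | x in setT].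

(* The closure of an operator is the operator whose graph is the closure in
   [H * H] of the graph. *)
Definition unitary_Lplus U : Prop :=
  Lplus U /\
  exists T, closure (op_graph U) = [set (x, T x) | x in setT] /\ unitary_on_H T.

End Operators.

Definition linear_on {R : pzRingType} {V W : lmodType R} (S : set V)
    (f : V -> W) : Prop :=
  forall (c : R) u v, S u -> S v -> f (c *: u + v) = c *: f u + f v.

(* Main.v *)
Require Import Defs.
From mathcomp Require Import all_boot all_order all_algebra sesquilinear.
From mathcomp Require Import complex.
From mathcomp Require Import boolp classical_sets functions reals topology normedtype.

Set Implicit Arguments.
Unset Strict Implicit.
Unset Printing Implicit Defensive.

Import Order.TTheory GRing.Theory Num.Theory Num.Def.

Local Open Scope classical_set_scope.
Local Open Scope ring_scope.

(** Write [x (x) y] for the operator [z |-> <z, y> x] on [D] (below [dyad x y]).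
A standard algebra contains all of them, and a triple automorphism can be read
off from its values on them.

The rank one operators are the nonzero [A] that are minimal, in the sense that
[A B^+ A] is a multiple of [A] for every [B] (lemma [minimal_is_dyad]). Since
[Phi] is bijective and respects the triple product, it maps [e (x) e], for a
unit vector [e], to a minimal operator; as [e (x) e] is its own triple product,
this image is [f (x) g] for two unit vectors [f] and [g] ([Phi_unit_dyad]).

From [x (x) e = (x (x) e) (e (x) e)^+ (e (x) e)] and its mirror image one gets
[Phi (x (x) e) = U x (x) g] and [Phi (e (x) y) = f (x) W y], where
[U x = Phi (x (x) e) g] and [W y = Phi (e (x) y)^+ f]. The scalars that come
out of triple products of such operators show that [U] and [W] preserve the
inner product, and surjectivity of [Phi] makes them onto [D]. An arbitrary [A]
of the algebra is then tested in the middle of a triple product: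
[(e (x) y) A^+ (z (x) e) = <A^+ z, y> e (x) e] is mapped to
[<Phi(A)^+ U z, W y> f (x) g], so that [<z, A y> = <U z, Phi(A) W y>], that is
[Phi(A) W = U A] ([Phi_intertwines]). Hence [Phi(A) = U A V] with [V = W^-1].

It remains that a surjective isometry [U] of [D] is unitary as an element of
[L^+(D)] ([isometry_unitary]). It is linear and its inverse is its adjoint, and
completeness of [H] extends both [U] and [U^-1] to isometries of [H]; these are
inverse to each other, and their graphs are the closures of the original
ones. *)

Lemma scale_injl (K : fieldType) (V : lmodType K) (x : V) (c d : K) :
  x != 0 -> c *: x = d *: x -> c = d.
Proof.
move=> x0 /eqP; rewrite -subr_eq0 -scalerBl scaler_eq0 (negPf x0) orbF.
by rewrite subr_eq0 => /eqP.
Qed.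

(** * Inner product and adjoints on a dense domain *)

Section HilbertDomain.
Context {R : realType} {H : completeNormedModType R[i]}.
Variables (ip : {dot H for conjC}) (D : submodClosed H).
Hypothesis ip_norm : forall x : H, `|x| ^+ 2 = ip x x.
Hypothesis D_dense : dense [set x : H | x \in D].

Definition dom_ip (x y : dom D) : R[i] := ip (val x) (val y).

Local Notation "'<< x , y >>" := (dom_ip x y)
  (format "''<<' x ,  y '>>'").

Implicit Types (x y z u v : dom D) (A B : dom D -> dom D).

Lemma ip_conj (x y : H) : ip x y = (ip y x)^*.
Proof. by rewrite hermC expr0 mul1r. Qed.

Lemma ipZl c (x y : H) : ip (c *: x) y = c * ip x y.
Proof. exact: linearZl_LR. Qed.

Lemma ipZr c (x y : H) : ip x (c *: y) = c^* * ip x y.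
Proof. exact: linearZr_LR. Qed.

Lemma ipBr (x y z : H) : ip x (y - z) = ip x y - ip x z.
Proof. exact: linearBr. Qed.

Lemma dom_val_inj x y : val x = val y -> x = y.
Proof. exact: val_inj. Qed.

Lemma dom_valB x y : val (x - y) = val x - val y. Proof. by []. Qed.

Lemma dense_approx (h : H) (e : R[i]) : 0 < e -> exists x, `|h - val x| < e.
Proof.
move=> e_gt0; have [||h' []] := @D_dense (ball h e).
- by exists h; apply: ballxx.
- exact: ball_open.
- by rewrite -ball_normE /= => hh' Dh'; exists (Sub h' Dh').
Qed.

(** If [h] is orthogonal to [D], then Pythagoras gives [|h - x| >= |h|] for all
[x] in [D], which by density is impossible for a nonzero [h]. *)
Lemma dense_ortho (h : H) : (forall x, ip (val x) h = 0) -> h = 0.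
Proof.
move=> ort; apply/eqP/negPn/negP => h0.
have [|x] := @dense_approx h `|h|; first by rewrite normr_gt0.
move=> lt_hx; have : `|h - val x| ^+ 2 < `|h| ^+ 2 by rewrite ltrXn2r.
rewrite !ip_norm dnormB /= (ip_conj h (val x)) ort !rmorph0 addr0 subr0.
by rewrite gtrDl le_gtF // dnorm_ge0.
Qed.

Lemma dom_ip_conj x y : '<<x, y>> = '<<y, x>>^*.
Proof. exact: ip_conj. Qed.

Lemma dom_ipDl x y z : '<<x + y, z>> = '<<x, z>> + '<<y, z>>.
Proof. exact: linearDl. Qed.

Lemma dom_ipZl c x y : '<<c *: x, y>> = c * '<<x, y>>.
Proof. exact: ipZl. Qed.

Lemma dom_ipDr x y z : '<<x, y + z>> = '<<x, y>> + '<<x, z>>.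
Proof. exact: linearDr. Qed.

Lemma dom_ipBr x y z : '<<x, y - z>> = '<<x, y>> - '<<x, z>>.
Proof. exact: linearBr. Qed.

Lemma dom_ipZr c x y : '<<x, c *: y>> = c^* * '<<x, y>>.
Proof. exact: ipZr. Qed.

Lemma dom_ip0l x : '<<0, x>> = 0.
Proof. exact: linear0l. Qed.

Lemma dom_ip_norm x : '<<x, x>> = `|val x| ^+ 2.
Proof. by rewrite ip_norm. Qed.

Lemma dom_ip_eq0 x : '<<x, x>> = 0 -> x = 0.
Proof.
move=> /eqP; rewrite dom_ip_norm expf_eq0 normr_eq0 => /eqP x0.
exact: dom_val_inj.
Qed.

Lemma dom_eq_of_ip x y : '<<x - y, x>> = '<<x - y, y>> -> x = y.
Proof. by move=> xy; apply/subr0_eq/dom_ip_eq0; rewrite dom_ipBr xy subrr. Qed.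

Lemma dom_ext x y : (forall z, '<<z, x>> = '<<z, y>>) -> x = y.
Proof. by move=> xy; apply: dom_eq_of_ip. Qed.

(** An explicit formal adjoint of [A] on [D]; exhibiting one is how membership
in [L^+(D)] and the values of [dagger] are established. *)
Definition adjoint_pair A B := forall x y, '<<A x, y>> = '<<x, B y>>.

Lemma adjoint_eq A B y : adjoint_pair A B -> adjoint ip A (val y) = val (B y).
Proof.
move=> AB; have AB_adj : is_adjoint ip A (val y) (val (B y)).
  by move=> x; apply: AB.
have adj : is_adjoint ip A (val y) (adjoint ip A (val y)).
  by apply: (xgetPex 0); exists (val (B y)).
apply/subr0_eq/dense_ortho => x.
by rewrite ipBr -adj -AB_adj subrr.
Qed.

Lemma Lplus_of_pair A B : linear A -> adjoint_pair A B -> Lplus ip A.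
Proof.
move=> A_lin AB; split=> // y.
split; last by rewrite (adjoint_eq y AB) (valP (B y)).
by exists (val (B y)) => x; apply: AB.
Qed.

Lemma dagger_eq A B : adjoint_pair A B -> dagger ip A = B.
Proof.
move=> AB; apply/funext => y; apply: dom_val_inj.
by rewrite /dagger (adjoint_eq y AB) insubdK ?(valP (B y)).
Qed.

Lemma dagger_pair A : Lplus ip A -> adjoint_pair A (dagger ip A).
Proof.
case=> _ A_adj x y; have [ex inD] := A_adj y.
rewrite /dom_ip /dagger insubdK //; exact: (xgetPex 0 ex).
Qed.

(** * Rank one operators *)

Definition dyad x y : dom D -> dom D := fun z => '<<z, y>> *: x.

Lemma dyad_pair x y : adjoint_pair (dyad x y) (dyad y x).
Proof.
by move=> z w; rewrite /dyad dom_ipZl dom_ipZr -dom_ip_conj mulrC.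
Qed.

Lemma dagger_dyad x y : dagger ip (dyad x y) = dyad y x.
Proof. exact/dagger_eq/dyad_pair. Qed.

Lemma dyad_linear x y : linear (dyad x y).
Proof.
by move=> c z w; rewrite /dyad dom_ipDl dom_ipZl scalerDl scalerA.
Qed.

Lemma dyad_Fin x y : Fin ip (dyad x y).
Proof.
split; first exact: Lplus_of_pair (@dyad_linear x y) (@dyad_pair x y).
exists 1%N, (fun=> x) => z; exists (fun=> '<<z, y>>).
by rewrite big_ord1.
Qed.

Lemma comp_dyad A x y : linear A -> A \o dyad x y = dyad (A x) y.
Proof.
by move=> A_lin; apply/funext => z; rewrite /dyad /= (scalable_linear A_lin).
Qed.

Lemma dyad_comp A x y : Lplus ip A -> dyad x y \o A = dyad x (dagger ip A y).
Proof.
by move=> A_Lp; apply/funext => z; rewrite /dyad /= (dagger_pair A_Lp).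
Qed.

Lemma dyad_scale c x y : dyad (c *: x) y = c *: dyad x y.
Proof. by apply/funext => z; rewrite /dyad fctE /= !scalerA mulrC. Qed.

Lemma dyad_dyad x y z w : dyad x y \o dyad z w = '<<z, y>> *: dyad x w.
Proof. by rewrite comp_dyad ?dyad_scale //; apply: dyad_linear. Qed.

Lemma dyad_dyad_unit e x y : '<<e, e>> = 1 -> dyad x e \o dyad e y = dyad x y.
Proof. by move=> e1; rewrite dyad_dyad e1 scale1r. Qed.

Lemma dyad_sandwich A x y z w : linear A ->
  dyad x y \o A \o dyad z w = '<<A z, y>> *: dyad x w.
Proof. by move=> A_lin; rewrite -compA comp_dyad // dyad_dyad. Qed.

Lemma dyad_triple a b c d p q :
  dyad a b \o dyad c d \o dyad p q = ('<<p, d>> * '<<c, b>>) *: dyad a q.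
Proof. by rewrite dyad_sandwich ?dom_ipZl //; apply: dyad_linear. Qed.

Lemma exists_unit_multiple x : x != 0 -> exists c, '<<c *: x, c *: x>> = 1.
Proof.
move=> x0; exists `|val x|^-1.
have nx0 : `|val x| != 0 by rewrite normr_eq0.
rewrite dom_ipZl dom_ipZr dom_ip_norm geC0_conj ?invr_ge0 //.
by rewrite mulrA -expr2 -exprMn mulVf // expr1n.
Qed.

Lemma unit_neq0 x : '<<x, x>> = 1 -> x != 0.
Proof.
move=> x1; apply/eqP => x0; move: x1; rewrite x0 dom_ip0l => /esym/eqP.
by rewrite oner_eq0.
Qed.

Lemma dyad_injl e x y : '<<e, e>> = 1 -> dyad x e = dyad y e -> x = y.
Proof.
by move=> e1 /(congr1 (fun A => A e)); rewrite /dyad e1 !scale1r.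
Qed.

Lemma dyad_injr e x y : '<<e, e>> = 1 -> dyad e x = dyad e y -> x = y.
Proof.
move=> e1 exy; apply: dom_ext => z; apply: (scale_injl (unit_neq0 e1)).
exact: (congr1 (fun A => A z) exy).
Qed.

Lemma dyad_scale_inj e f c d : '<<e, e>> = 1 -> '<<f, f>> = 1 ->
  c *: dyad e f = d *: dyad e f -> c = d.
Proof.
move=> e1 f1; rewrite -!dyad_scale => /(dyad_injl f1).
exact/scale_injl/unit_neq0.
Qed.

(** Testing minimality against [u (x) A u], with [u] scaled so that [A u] is a
unit vector, gives [<A z, A u> A u = l A z] for all [z]; the choice [z := u]
forces [l = 1], so every value of [A] is a multiple of [A u]. *)
Lemma minimal_is_dyad A u0 : Lplus ip A -> A u0 != 0 ->
    (forall u v, exists l, A \o dyad u v \o A = l *: A) ->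
  exists f g, '<<f, f>> = 1 /\ A = dyad f g.
Proof.
move=> A_Lp Au0 A_minimal; have A_lin := A_Lp.1.
have [c] := exists_unit_multiple Au0; rewrite -(scalable_linear A_lin).
set u := c *: u0 => f1; exists (A u), (dagger ip A (A u)); split=> //.
have [l Al] := A_minimal u (A u).
have Al' z : '<<A z, A u>> *: A u = l *: A z.
  by have := congr1 (fun B => B z) Al; rewrite comp_dyad.
have l1 : 1 = l.
  by apply: (scale_injl (unit_neq0 f1)); rewrite -Al' f1.
apply/funext => z; rewrite /dyad -(dagger_pair A_Lp) Al' -l1.
by rewrite scale1r.
Qed.

(** * Surjective isometries of the domain are unitary *)

(** Metric form of membership in the closure of the graph of [U]. *)
Definition graph_limit U (h k : H) := forall e : R[i], 0 < e ->
  exists x, `|h - val x| < e /\ `|k - val (U x : dom D)| < e.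

Lemma closure_op_graphP U (h k : H) :
  closure (op_graph U) (h, k) <-> graph_limit U h k.
Proof.
split=> [cl e e0|gl B /nbhs_ballP[e e0 eB]].
  have [] := cl (ball (h, k) e); first exact: nbhsx_ballx.
  move=> _ [[x _ <-]] [] /=; rewrite -ball_normE /= => hx kx.
  by exists x.
have [x [hx kx]] := gl e e0.
exists (val x, val (U x)); split; first by exists x.
by apply: eB; split; rewrite -ball_normE.
Qed.

Section Isometry.
Variable U : dom D -> dom D.
Hypothesis U_ip : forall x y, '<<U x, U y>> = '<<x, y>>.

Lemma isometry_inj : injective U.
Proof.
by move=> x y Uxy; apply: dom_ext => z; rewrite -U_ip Uxy U_ip.
Qed.

(** Linearity is automatic: [U (c x + y)] and [c U x + U y] have the same inner
product with every [U z], and these fill [D]. *)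
Lemma isometry_linear U' : cancel U' U -> linear U.
Proof.
move=> U'K c x y; apply: dom_ext => z; rewrite -(U'K z) U_ip.
by rewrite !dom_ipDr !dom_ipZr !U_ip.
Qed.

Lemma isometry_norm x : `|val (U x)| = `|val x|.
Proof. by apply/eqP; rewrite -(@eqrXn2 _ 2) // -!dom_ip_norm U_ip. Qed.

Hypothesis U_lin : linear U.

Lemma graph_limit_linear c h k h' k' : graph_limit U h k ->
  graph_limit U h' k' -> graph_limit U (c *: h + h') (c *: k + k').
Proof.
move=> hk hk' e e0; pose d := e / (`|c| + 1).
have c0 : 0 < `|c| + 1 by rewrite ltr_wpDl.
have d0 : 0 < d by rewrite divr_gt0.
have [x [hx kx]] := hk d d0; have [x' [hx' kx']] := hk' d d0.
have small (p q p' q' : H) : `|p - q| < d -> `|p' - q'| < d ->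
    `|c *: p + p' - (c *: q + q')| < e.
  move=> pq pq'; rewrite opprD addrACA -scalerBr.
  apply: (le_lt_trans (ler_normD _ _)); rewrite normrZ.
  have -> : e = `|c| * d + d.
    by rewrite -[X in _ + X]mul1r -mulrDl /d mulrCA mulfV ?mulr1 // gt_eqF.
  by rewrite ler_ltD // ler_wpM2l // ltW.
by exists (c *: x + x'); split; rewrite ?U_lin; apply: small.
Qed.

Lemma graph_limit_norm h k : graph_limit U h k -> `|k| = `|h|.
Proof.
move=> hk; apply/eqP; rewrite eq_le; apply/andP.
have norm_le_of_near (p q p' q' : H) (e : R[i]) : `|q| = `|q'| ->
    `|p - q| < e / 2 -> `|p' - q'| < e / 2 -> `|p| <= `|p'| + e.
  move=> qq pq pq'.
  have p_le : `|p| <= `|p - q| + `|q'|.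
    by rewrite -qq -{1}[p](subrK q) ler_normD.
  have q_le : `|q'| <= `|p' - q'| + `|p'|.
    by rewrite distrC -{1}[q'](subrK p') ler_normD.
  apply: (le_trans p_le); apply: (le_trans (lerD (ltW pq) q_le)).
  by rewrite addrA addrC [in leRHS](splitr e) !lerD2l ltW.
split; apply/ler_addgt0Pr => e e0; have [|x [hx kx]] := hk (e / 2).
- by rewrite divr_gt0.
- by apply: norm_le_of_near kx hx; rewrite isometry_norm.
- by rewrite divr_gt0.
- by apply: norm_le_of_near hx kx; rewrite isometry_norm.
Qed.

Lemma graph_limit_fun h k k' :
  graph_limit U h k -> graph_limit U h k' -> k = k'.
Proof.
move=> hk hk'; apply/eqP; rewrite -subr_eq0 -normr_eq0.
have := graph_limit_norm (graph_limit_linear (-1) hk' hk).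
by rewrite !scaleN1r !(addrC (- _)) subrr normr0 => ->.
Qed.

(** The images of the traces on [D] of the balls around [h] generate a filter,
proper because [D] is dense and Cauchy because [U] is isometric. Its limit is
the wanted point. *)
Lemma graph_limit_total h : exists k, graph_limit U h k.
Proof.
pose near_h (e : R[i]) := [set val (U x) | x in [set x | `|h - val x| < e]].
pose F := filter_from [set e : R[i] | 0 < e] near_h.
have F_filter : Filter F.
  apply: filter_from_filter; first by exists 1; apply: ltr01.
  (* The order of [R[i]] is partial, but positive numbers are comparable. *)
  move=> a b /= a0 b0.
  have [ab|/ltW ba] := real_leP (gtr0_real a0) (gtr0_real b0).
    exists a => // _ [x /= hx <-]; split; exists x => //=.
    exact: lt_le_trans ab.
  exists b => // _ [x /= hx <-]; split; exists x => //=.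
  exact: lt_le_trans ba.
have F_proper : ProperFilter F.
  apply: filter_from_proper => // e /= /(dense_approx h)[x hx].
  by exists (val (U x)), x.
have F_cauchy : cauchy F.
  apply: cauchy_exP => e e0; have e20 : 0 < e / 2 by rewrite divr_gt0.
  have [x hx] := dense_approx h e20; exists (val (U x)), (e / 2) => //.
  move=> _ [y /= hy <-]; rewrite -ball_normE /=.
  rewrite -dom_valB -(zmod_morphism_linear U_lin) isometry_norm dom_valB.
  rewrite [e]splitr.
  by rewrite -(subrKA h); apply: (le_lt_trans (ler_normD _ _));
    rewrite ltrD // distrC.
exists (lim F) => e e0.
have F_lim : F (ball (lim F) e).
  by apply: (cauchy_cvg F F_cauchy); exact: nbhsx_ballx.
have F_near : F (near_h e) by exists e.
have [k [kx [x /= hx xk]]] := filter_ex (filterI F_lim F_near).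
by exists x; split=> //; move: kx; rewrite -xk -ball_normE.
Qed.

End Isometry.

(** Polarization: comparing the norms of [h + k] and [h + 'i k] determines the
real and the imaginary part of the inner product. *)
Lemma norm_preserving_ip (T : H -> H) : linear T -> (forall h, `|T h| = `|h|) ->
  forall h k, ip (T h) (T k) = ip h k.
Proof.
move=> T_lin T_norm.
have T_dnorm h : ip (T h) (T h) = ip h h by rewrite -!ip_norm T_norm.
have T_re h k : ip (T h) (T k) + (ip (T h) (T k))^* = ip h k + (ip h k)^*.
  have := T_dnorm (h + k).
  rewrite -{1 2}[h]scale1r T_lin scale1r !dnormD !T_dnorm.
  exact: addrI.
move=> h k; have := T_re h ('i *: k); rewrite (scalable_linear T_lin) !ipZr.
rewrite !rmorphM /= conjCK conjCi !mulNr ![- _ + _]addrC -!mulrBr.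
move=> /(mulfI (neq0Ci _)) T_im.
(* [T_re] and [T_im] give [t + t^*] and [t^* - t], whose difference is [2 t]. *)
have double (s : R[i]) : s + s = (s + s^*) - (s^* - s).
  by rewrite opprB addrA addrAC addrK.
have : ip (T h) (T k) *+ 2 = ip h k *+ 2 by rewrite !mulr2n !double T_re T_im.
by move/eqP; rewrite eqrMn2r // => /eqP.
Qed.

(** The closure of the graph of [U^-1] is the transpose of that of [U]. Both are
graphs of everywhere defined isometric maps, so the extension of [U^-1] inverts
the extension of [U]. *)
Lemma isometry_unitary U U' : (forall x y, '<<U x, U y>> = '<<x, y>>) ->
  cancel U' U -> unitary_Lplus ip U.
Proof.
move=> U_ip U'K; have UK : cancel U U'.
  by move=> x; apply: (isometry_inj U_ip); rewrite U'K.
have U'_ip x y : '<<U' x, U' y>> = '<<x, y>> by rewrite -U_ip !U'K.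
have U_lin := isometry_linear U_ip U'K.
have U'_lin := isometry_linear U'_ip UK.
have [T TP] := choice (graph_limit_total U_ip U_lin).
have [T' T'P] := choice (graph_limit_total U'_ip U'_lin).
have inverse_limit A B h k :
    cancel A B -> graph_limit A h k -> graph_limit B k h.
  by move=> AK hk e /hk[x [hx kx]]; exists (A x); rewrite AK.
split; first by apply: (@Lplus_of_pair _ U') => // x y; rewrite -(U_ip x) U'K.
exists T; split.
  apply/seteqP; split=> [[h k] /closure_op_graphP hk|_ [h _ <-]].
    by exists h => //; rewrite (graph_limit_fun U_ip U_lin hk (TP h)).
  exact/closure_op_graphP.
have T_lin : linear T.
  move=> c h k; apply: (graph_limit_fun U_ip U_lin (TP _)).
  exact: graph_limit_linear.
split=> //; last first.
  by apply: norm_preserving_ip => // h; apply: (graph_limit_norm U_ip).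
exists T' => h.
  by apply: (graph_limit_fun U'_ip U'_lin (T'P _)); apply: inverse_limit (TP h).
by apply: (graph_limit_fun U_ip U_lin (TP _)); apply: inverse_limit (T'P h).
Qed.

Lemma unitary_id : unitary_Lplus ip (@id (dom D)).
Proof. exact: (@isometry_unitary _ id). Qed.

(** * The structure of triple automorphisms *)

Section TripleAutomorphism.
Variable AA : set (dom D -> dom D).
Variable Phi : (dom D -> dom D) -> dom D -> dom D.
Hypothesis AA_std : standard_star_algebra ip AA.
Hypothesis Phi_bij : set_bij AA AA Phi.
Hypothesis Phi_lin : linear_on AA Phi.
Hypothesis Phi_triple : forall A B C, AA A -> AA B -> AA C ->
  Phi (A \o dagger ip B \o C) = Phi A \o dagger ip (Phi B) \o Phi C.

Lemma AA_Lplus A : AA A -> Lplus ip A.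
Proof. by have [[sub _ _ _ _] _] := AA_std; apply: sub. Qed.

Lemma AA_dyad x y : AA (dyad x y).
Proof. by have [_ sub] := AA_std; apply/sub/dyad_Fin. Qed.

Lemma AA_dagger A : AA A -> AA (dagger ip A).
Proof. by have [[_ _ _ _ dag] _] := AA_std; apply: dag. Qed.

Lemma AA_Phi A : AA A -> AA (Phi A).
Proof. by have [fun_Phi _ _] := Phi_bij; apply: fun_Phi. Qed.

Lemma Phi_surj B : AA B -> exists2 A, AA A & Phi A = B.
Proof. by have [_ _ surj] := Phi_bij => /surj[A AA_A <-]; exists A. Qed.

Lemma Phi_inj A B : AA A -> AA B -> Phi A = Phi B -> A = B.
Proof.
have [_ inj _] := Phi_bij => AA_A AA_B; apply: inj; exact: mem_set.
Qed.

Lemma Phi0 : Phi 0 = 0.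
Proof.
have [[_ AA0 _ _ _] _] := AA_std; have := Phi_lin 1 AA0 AA0.
by rewrite !scale1r addr0 -[LHS]addr0 => /addrI.
Qed.

Lemma PhiZ c A : AA A -> Phi (c *: A) = c *: Phi A.
Proof.
have [[_ AA0 _ _ _] _] := AA_std => AA_A.
by rewrite -[c *: A]addr0 Phi_lin // Phi0 addr0.
Qed.

(** Minimality of [e (x) e] passes to its image because [Phi] is onto the
algebra, which contains every test operator [u (x) v]. With [f] a unit vector,
[g] is one too, because [(f (x) g) (f (x) g)^+ (f (x) g)] equals both
[f (x) g] and [<g, g> f (x) g]. *)
Lemma Phi_unit_dyad e : '<<e, e>> = 1 ->
  exists f g, [/\ '<<f, f>> = 1, '<<g, g>> = 1 & Phi (dyad e e) = dyad f g].
Proof.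
move=> e1; have AA_e := AA_dyad e e.
have Phie_Lp := AA_Lplus (AA_Phi AA_e).
have [u Phieu] : exists u, Phi (dyad e e) u != 0.
  apply/not_existsP => Phie0; have ee0 : dyad e e = 0.
    have [[_ AA0 _ _ _] _] := AA_std; apply: Phi_inj => //; rewrite Phi0.
    by apply/funext => u; apply/eqP/negPn/negP; apply: Phie0.
  have : dyad e e e = 0 by rewrite ee0.
  by rewrite /dyad e1 scale1r => e0; have := unit_neq0 e1; rewrite e0 eqxx.
have [u' v'|f [g [f1 Phief]]] := minimal_is_dyad Phie_Lp Phieu.
  (* [u' (x) v'] is the adjoint of [v' (x) u' = Phi B], and
     [(e (x) e) B^+ (e (x) e) = <B^+ e, e> e (x) e]. *)
  have [B AA_B PhiB] := Phi_surj (AA_dyad v' u'); exists '<<dagger ip B e, e>>.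
  rewrite -(dagger_dyad v' u') -PhiB -Phi_triple // -PhiZ //.
  congr Phi; apply: dyad_sandwich.
  exact: (AA_Lplus (AA_dagger AA_B)).1.
exists f, g; split=> //; have := Phi_triple AA_e AA_e AA_e.
rewrite Phief !dagger_dyad !dyad_triple e1 f1 !mul1r scale1r Phief.
move=> /(congr1 (fun A => A u)) gg; rewrite Phief in Phieu.
by apply: (scale_injl Phieu); rewrite scale1r [RHS]gg.
Qed.

Section UnitVector.
Variables e f g : dom D.
Hypotheses (e1 : '<<e, e>> = 1) (f1 : '<<f, f>> = 1) (g1 : '<<g, g>> = 1).
Hypothesis Phi_e : Phi (dyad e e) = dyad f g.

Let U x := Phi (dyad x e) g.
Let W y := dagger ip (Phi (dyad e y)) f.

Lemma Phi_dyadl x : Phi (dyad x e) = dyad (U x) g.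
Proof.
have := Phi_triple (AA_dyad x e) (AA_dyad e e) (AA_dyad e e).
rewrite Phi_e !dagger_dyad !(dyad_dyad_unit _ _ e1) -compA => ->.
rewrite (dyad_dyad_unit _ _ f1) comp_dyad //.
exact: (AA_Lplus (AA_Phi (AA_dyad x e))).1.
Qed.

Lemma Phi_dyadr y : Phi (dyad e y) = dyad f (W y).
Proof.
have := Phi_triple (AA_dyad e e) (AA_dyad e e) (AA_dyad e y).
rewrite Phi_e !dagger_dyad !(dyad_dyad_unit _ _ e1).
rewrite (dyad_dyad_unit _ _ g1) => ->.
exact/dyad_comp/AA_Lplus/AA_Phi/AA_dyad.
Qed.

(** [Phi] maps [(e (x) e) (y (x) e)^+ (x (x) e) = <x, y> e (x) e] to
[<U x, U y> f (x) g]. *)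
Lemma left_isometry x y : '<<U x, U y>> = '<<x, y>>.
Proof.
have := Phi_triple (AA_dyad e e) (AA_dyad y e) (AA_dyad x e).
rewrite Phi_e !Phi_dyadl !dagger_dyad !dyad_triple e1 g1 !mulr1.
by rewrite PhiZ ?Phi_e; [move=> /(dyad_scale_inj f1 g1)|apply: AA_dyad].
Qed.

(** [Phi] maps [(e (x) y) (e (x) x)^+ (e (x) e) = <x, y> e (x) e] to
[<W x, W y> f (x) g]. *)
Lemma right_isometry x y : '<<W x, W y>> = '<<x, y>>.
Proof.
have := Phi_triple (AA_dyad e y) (AA_dyad e x) (AA_dyad e e).
rewrite Phi_e !Phi_dyadr !dagger_dyad !dyad_triple e1 f1 !mul1r.
by rewrite PhiZ ?Phi_e; [move=> /(dyad_scale_inj f1 g1)|apply: AA_dyad].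
Qed.

(** If [Phi B = z (x) g], then [B] and [B (e (x) e)^+ (e (x) e) = B e (x) e]
have the same image [z (x) g = U (B e) (x) g], so [z = U (B e)]. *)
Lemma left_surj z : exists x, U x = z.
Proof.
have [B AA_B PhiB] := Phi_surj (AA_dyad z g); exists (B e).
apply: (dyad_injl g1); rewrite -Phi_dyadl -PhiB.
rewrite -(comp_dyad e e (AA_Lplus AA_B).1) -(dyad_dyad_unit e e e1).
rewrite compA -{1}(dagger_dyad e e) Phi_triple //; try exact: AA_dyad.
rewrite Phi_e PhiB dagger_dyad.
by rewrite (dyad_dyad_unit _ _ g1) (dyad_dyad_unit _ _ f1).
Qed.

(** Mirror image of [left_surj]: if [Phi B = f (x) z], then [z = W (B^+ e)]. *)
Lemma right_surj z : exists y, W y = z.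
Proof.
have [B AA_B PhiB] := Phi_surj (AA_dyad f z); exists (dagger ip B e).
apply: (dyad_injr f1); rewrite -Phi_dyadr -PhiB.
rewrite -(dyad_comp e e (AA_Lplus AA_B)) -(dyad_dyad_unit e e e1).
rewrite -{2}(dagger_dyad e e) Phi_triple //; try exact: AA_dyad.
rewrite Phi_e PhiB dagger_dyad.
by rewrite (dyad_dyad_unit _ _ g1) (dyad_dyad_unit _ _ f1).
Qed.

(** Both sides of [(e (x) y) A^+ (z (x) e) = <A^+ z, y> e (x) e] are mapped to
multiples of [f (x) g]; comparing the coefficients gives
[<Phi(A)^+ U z, W y> = <A^+ z, y>]. *)
Lemma Phi_intertwines A y : AA A -> Phi A (W y) = U (A y).
Proof.
move=> AA_A; apply: dom_ext => z'; have [z <-] := left_surj z'.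
rewrite left_isometry dom_ip_conj [RHS]dom_ip_conj; congr (_^*).
rewrite (dagger_pair (AA_Lplus AA_A)) (dagger_pair (AA_Lplus (AA_Phi AA_A))).
rewrite dom_ip_conj [RHS]dom_ip_conj; congr (_^*).
have lin_dagger B : AA B -> linear (dagger ip B).
  by move=> AA_B; exact: (AA_Lplus (AA_dagger AA_B)).1.
have := Phi_triple (AA_dyad e y) AA_A (AA_dyad z e).
rewrite Phi_dyadl Phi_dyadr (dyad_sandwich _ _ _ _ (lin_dagger _ AA_A)).
rewrite (dyad_sandwich _ _ _ _ (lin_dagger _ (AA_Phi AA_A))).
by rewrite PhiZ ?Phi_e; [move=> /(dyad_scale_inj f1 g1)|apply: AA_dyad].
Qed.

Lemma Phi_unitary_equivalence : exists U V : dom D -> dom D,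
  [/\ unitary_Lplus ip U, unitary_Lplus ip V &
      forall A, AA A -> Phi A = U \o A \o V].
Proof.
have [U' U'K] := choice left_surj; have [W' W'K] := choice right_surj.
have WK : cancel W W'.
  by move=> x; apply: (isometry_inj right_isometry); rewrite W'K.
exists U, W'; split.
- exact: isometry_unitary left_isometry U'K.
- by apply: isometry_unitary WK => x y; rewrite -right_isometry !W'K.
- by move=> A AA_A; apply/funext => x; rewrite /= -Phi_intertwines ?W'K.
Qed.

End UnitVector.
End TripleAutomorphism.
End HilbertDomain.

Theorem proposition3p5 (R : realType) (H : completeNormedModType R[i])
    (ip : {dot H for conjC}) (ip_norm : forall x : H, `|x| ^+ 2 = ip x x)
    (D : submodClosed H) (D_dense : dense [set x : H | x \in D])
    (AA : set (dom D -> dom D)) (AA_std : standard_star_algebra ip AA)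
    (Phi : (dom D -> dom D) -> (dom D -> dom D))
    (Phi_bij : set_bij AA AA Phi) (Phi_lin : linear_on AA Phi)
    (Phi_triple : forall A B C : dom D -> dom D, AA A -> AA B -> AA C ->
       Phi (A \o dagger ip B \o C) = Phi A \o dagger ip (Phi B) \o Phi C) :
  exists U V : dom D -> dom D,
    [/\ unitary_Lplus ip U, unitary_Lplus ip V &
        forall A : dom D -> dom D, AA A -> Phi A = U \o A \o V].
Proof.
have [[x x0]|no_vector] := pselect (exists x : dom D, x != 0).
  have [c cx1] := exists_unit_multiple ip_norm x0.
  have [f [g [f1 g1 Phi_e]]] :=
    Phi_unit_dyad ip_norm D_dense AA_std Phi_bij Phi_lin Phi_triple cx1.
  exact: (Phi_unitary_equivalence ip_norm D_dense AA_std Phi_bij Phi_lin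
            Phi_triple cx1 f1 g1 Phi_e).
have dom0 (x : dom D) : x = 0.
  by apply/eqP/negPn/negP => x0; apply: no_vector; exists x.
(* Without nonzero vectors in [D] there is only one operator on [D]. *)
exists id, id; split; [exact: unitary_id|exact: unitary_id|].
by move=> A _; apply/funext => x; rewrite [LHS]dom0 [RHS]dom0.
Qed.
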